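(* Let $p$ be a prime number and $d\ge 2$ an integer. With respect to the Haar measure, the probability that a degree $d$ monic polynomial over $\mathbf{Z}_p$ is separable is $1-p^{-1}$; that is, $$\mu^d_{\mathrm{Haar}}\left(S^d_{\mathbf{Z}_p}\right)=1-p^{-1},$$ where $S^d_{\mathbf{Z}_p}\subset P_d(\mathbf{Z}_p)$ denotes the set of separable monic polynomials of degree $d$ in $\mathbf{Z}_p[x]$.
   Context: $\mathbf{Z}_p=\varprojlim \mathbf{Z}/p^k\mathbf{Z}$ is the ring of $p$-adic integers. For a commutative ring $R$, a polynomial $f\in R[x]$ is called separable if $A=R[x]/f$ is a separable $R$-algebra, i.e. $A$ is projective as an $A\otimes_R A$-module. When $f$ is monic this is equivalent to $(f,f')=R[x]$, where $f'$ is the formal derivative of $f$ and $(f,f')$ is the ideal of $R[x]$ generated by $f$ and $f'$. $P_d(\mathbf{Z}_p)$ denotes the set of monic polynomials of degree $d$ over $\mathbf{Z}_p$, identified with $\mathbf{Z}_p^d$ by sending $x^d+a_{d-1}x^{d-1}+\cdots+a_0$ to $(a_0,\ldots,a_{d-1})$. $\mu_{\mathrm{Haar}}$ is the unique Haar measure on $\mathbf{Z}_p$ of total mass $1$, and $\mu^d_{\mathrm{Haar}}$ is the resulting product measure on $P_d(\mathbf{Z}_p)=\mathbf{Z}_p^d$. *)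

(* Defs.v *)
From HB Require Import structures.
From mathcomp Require Import all_boot all_order all_algebra.
From mathcomp Require Import generic_quotient qpoly.
From mathcomp Require Import all_classical all_reals all_analysis.

Set Implicit Arguments.
Unset Strict Implicit.
Unset Printing Implicit Defensive.
Import Order.TTheory GRing.Theory Num.Theory.
Local Open Scope classical_set_scope.
Local Open Scope quotient_scope.
Local Open Scope ring_scope.

Section TensorProduct.
Variables (R : comNzRingType) (A B : comAlgType R).

Definition bilinear_map (M : lmodType R) (b : A -> B -> M) : Prop :=
  (forall x, linear (b x)) /\ (forall y, linear (b^~ y)).

Definition tsum (M : lmodType R) (b : A -> B -> M) (s : seq (A * B)) : M :=
  \sum_(xy <- s) b xy.1 xy.2.

(* A list [:: (x1, y1); ...; (xn, yn)] stands for x1 (x) y1 + ... + xn (x) yn;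
   two such formal sums are identified when no R-bilinear map out of A x B
   separates them. *)
Definition tequiv (s t : seq (A * B)) : bool :=
  `[< forall (M : lmodType R) (b : A -> B -> M),
        bilinear_map b -> tsum b s = tsum b t >].

Lemma tequivP s t :
  reflect (forall (M : lmodType R) (b : A -> B -> M),
             bilinear_map b -> tsum b s = tsum b t) (tequiv s t).
Proof. exact: asboolP. Qed.

Lemma tequiv_refl : reflexive tequiv.
Proof. by move=> s; apply/tequivP. Qed.

Lemma tequiv_sym : symmetric tequiv.
Proof.
by move=> s t; apply/tequivP/tequivP => e M b bb; rewrite (e M b bb).
Qed.

Lemma tequiv_trans : transitive tequiv.
Proof.
move=> t s u /tequivP st /tequivP tu; apply/tequivP => M b bb.
by rewrite st // tu.
Qed.

Definition tequiv_rel := EquivRel tequiv tequiv_refl tequiv_sym tequiv_trans.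

Definition tensor := {eq_quot tequiv_rel}.
HB.instance Definition _ := Choice.on tensor.
HB.instance Definition _ := EqQuotient.on tensor.

Definition tens (s : seq (A * B)) : tensor := \pi_tensor s.
Definition tlist (u : tensor) : seq (A * B) := repr u.

Lemma tlistK u : tens (tlist u) = u.
Proof. exact: reprK. Qed.

Lemma tensP s t :
  (tens s = tens t) <-> (forall (M : lmodType R) (b : A -> B -> M),
     bilinear_map b -> tsum b s = tsum b t).
Proof.
split=> [/eqmodP/tequivP //|e]; apply/eqmodP; exact/tequivP.
Qed.

Lemma tsum_list (M : lmodType R) (b : A -> B -> M) s :
  bilinear_map b -> tsum b (tlist (tens s)) = tsum b s.
Proof. by move=> bb; apply: (tensP _ _).1 bb; rewrite tlistK. Qed.

Lemma tsumD (M : lmodType R) (b : A -> B -> M) s t :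
  tsum b (s ++ t) = tsum b s + tsum b t.
Proof. exact: big_cat. Qed.

Definition topp (s : seq (A * B)) := [seq (- xy.1, xy.2) | xy <- s].
Definition tscale (r : R) (s : seq (A * B)) :=
  [seq (r *: xy.1, xy.2) | xy <- s].
Definition tmul (s t : seq (A * B)) :=
  [seq (x.1 * y.1, x.2 * y.2) | x <- s, y <- t].

Section BilinearMap.
Variables (M : lmodType R) (b : A -> B -> M).
Hypothesis bb : bilinear_map b.

Lemma bilinDl x x' y : b (x + x') y = b x y + b x' y.
Proof. by have := bb.2 y 1 x x'; rewrite !scale1r. Qed.

Lemma bilinDr x y y' : b x (y + y') = b x y + b x y'.
Proof. by have := bb.1 x 1 y y'; rewrite !scale1r. Qed.

Lemma bilin0l y : b 0 y = 0.
Proof. by apply: (addrI (b 0 y)); rewrite -bilinDl !addr0. Qed.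

Lemma bilin0r x : b x 0 = 0.
Proof. by apply: (addrI (b x 0)); rewrite -bilinDr !addr0. Qed.

Lemma bilinZl r x y : b (r *: x) y = r *: b x y.
Proof. by have := bb.2 y r x 0; rewrite !addr0 bilin0l addr0. Qed.

Lemma bilinZr r x y : b x (r *: y) = r *: b x y.
Proof. by have := bb.1 x r y 0; rewrite !addr0 bilin0r addr0. Qed.

Lemma bilinNl x y : b (- x) y = - b x y.
Proof. by rewrite -[- x]scaleN1r bilinZl scaleN1r. Qed.

Lemma tsumN s : tsum b (topp s) = - tsum b s.
Proof.
rewrite /tsum big_map -sumrN; apply: eq_bigr => xy _; exact: bilinNl.
Qed.

Lemma tsumZ r s : tsum b (tscale r s) = r *: tsum b s.
Proof.
rewrite /tsum big_map scaler_sumr; apply: eq_bigr => xy _; exact: bilinZl.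
Qed.

Lemma tsumM s t : tsum b (tmul s t) =
  \sum_(x <- s) \sum_(y <- t) b (x.1 * y.1) (x.2 * y.2).
Proof. by rewrite /tsum /tmul big_allpairs_dep. Qed.

Lemma bilinMr (y : A * B) : bilinear_map (fun u v => b (u * y.1) (v * y.2)).
Proof.
split=> z r u v.
  by rewrite mulrDl -scalerAl bilinDr bilinZr.
by rewrite mulrDl -scalerAl bilinDl bilinZl.
Qed.

Lemma bilinMl (x : A * B) : bilinear_map (fun u v => b (x.1 * u) (x.2 * v)).
Proof.
split=> z r u v.
  by rewrite mulrDr -scalerAr bilinDr bilinZr.
by rewrite mulrDr -scalerAr bilinDl bilinZl.
Qed.

End BilinearMap.

Definition tensD u v := tens (tlist u ++ tlist v).
Definition tensN u := tens (topp (tlist u)).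
Definition tensM u v := tens (tmul (tlist u) (tlist v)).
Definition tensZ r u := tens (tscale r (tlist u)).

Lemma tensDE s t : tensD (tens s) (tens t) = tens (s ++ t).
Proof. by apply/tensP => M b bb; rewrite !tsumD !tsum_list. Qed.

Lemma tensNE s : tensN (tens s) = tens (topp s).
Proof. by apply/tensP => M b bb; rewrite !tsumN // tsum_list. Qed.

Lemma tensZE r s : tensZ r (tens s) = tens (tscale r s).
Proof. by apply/tensP => M b bb; rewrite !tsumZ // tsum_list. Qed.

Lemma tensME s t : tensM (tens s) (tens t) = tens (tmul s t).
Proof.
apply/tensP => M b bb; rewrite !tsumM //.
have E x : \sum_(y <- tlist (tens t)) b (x.1 * y.1) (x.2 * y.2) =
    \sum_(y <- t) b (x.1 * y.1) (x.2 * y.2) := tsum_list t (bilinMl bb x).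
under eq_bigr do rewrite E.
rewrite exchange_big [RHS]exchange_big; apply: eq_bigr => y _.
exact: (tsum_list s (bilinMr bb y)).
Qed.

Let tensW (P : tensor -> Prop) : (forall s, P (tens s)) -> forall u, P u.
Proof. by move=> Ps u; rewrite -(tlistK u). Qed.

Lemma tensDA : associative tensD.
Proof.
elim/tensW => s; elim/tensW => t; elim/tensW => u.
by rewrite !tensDE catA.
Qed.

Lemma tensDC : commutative tensD.
Proof.
elim/tensW => s; elim/tensW => t; rewrite !tensDE.
by apply/tensP => M b bb; rewrite !tsumD addrC.
Qed.

Lemma tens0D : left_id (tens [::]) tensD.
Proof. by elim/tensW => s; rewrite tensDE. Qed.

Lemma tensND : left_inverse (tens [::]) tensN tensD.
Proof.
elim/tensW => s; rewrite tensNE tensDE; apply/tensP => M b bb.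
by rewrite tsumD tsumN // addNr /tsum big_nil.
Qed.

HB.instance Definition _ :=
  GRing.isZmodule.Build tensor tensDA tensDC tens0D tensND.

Lemma tensMA : associative tensM.
Proof.
elim/tensW => s; elim/tensW => t; elim/tensW => u; rewrite !tensME.
apply/tensP => M b bb; rewrite !tsumM // /tmul big_allpairs_dep /=.
apply: eq_bigr => x _; rewrite big_allpairs_dep /=; apply: eq_bigr => y _.
by apply: eq_bigr => z _; rewrite !mulrA.
Qed.

Lemma tensMC : commutative tensM.
Proof.
elim/tensW => s; elim/tensW => t; rewrite !tensME.
apply/tensP => M b bb; rewrite !tsumM // exchange_big.
apply: eq_bigr => x _; apply: eq_bigr => y _.
by rewrite [x.1 * _]mulrC [x.2 * _]mulrC.
Qed.

Lemma tens1M : left_id (tens [:: (1, 1)]) tensM.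
Proof.
elim/tensW => s; rewrite tensME; apply/tensP => M b bb.
rewrite tsumM // big_seq1; apply: eq_bigr => x _.
by rewrite !mul1r.
Qed.

Lemma tensMDl : left_distributive tensM (@GRing.add tensor).
Proof.
elim/tensW => s; elim/tensW => t; elim/tensW => u.
rewrite [X in tensM X _]tensDE !tensME [RHS]tensDE.
by apply/tensP => M b bb; rewrite tsumD !tsumM // big_cat.
Qed.

HB.instance Definition _ :=
  GRing.Zmodule_isComPzRing.Build tensor tensMA tensMC tens1M tensMDl.

Lemma tensZA r r' u : tensZ r (tensZ r' u) = tensZ (r * r') u.
Proof.
elim/tensW: u => s; rewrite !tensZE; apply/tensP => M b bb.
by rewrite !tsumZ // scalerA.
Qed.

Lemma tens1Z : left_id 1 tensZ.
Proof.
elim/tensW => s; rewrite tensZE; apply/tensP => M b bb.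
by rewrite tsumZ // scale1r.
Qed.

Lemma tensZDr : right_distributive tensZ (@GRing.add tensor).
Proof.
move=> r; elim/tensW => s; elim/tensW => t.
rewrite [X in tensZ _ X]tensDE !tensZE [RHS]tensDE; apply/tensP => M b bb.
by rewrite tsumD !tsumZ // tsumD scalerDr.
Qed.

Lemma tensZDl u : {morph tensZ^~ u : r r' / r + r'}.
Proof.
move=> r r'; elim/tensW: u => s; rewrite !tensZE [RHS]tensDE.
apply/tensP => M b bb.
by rewrite tsumD !tsumZ // scalerDl.
Qed.

HB.instance Definition _ :=
  GRing.Zmodule_isLmodule.Build R tensor tensZA tens1Z tensZDr tensZDl.

Definition pure (x : A) (y : B) : tensor := tens [:: (x, y)].

Lemma pure_bilinear : bilinear_map pure.
Proof.
split=> z r u v; rewrite [X in _ = X + _]tensZE [RHS]tensDE; apply/tensP => M b bb.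
  by rewrite tsumD tsumZ // /tsum !big_seq1 /= bilinDr // bilinZr.
by rewrite tsumD tsumZ // /tsum !big_seq1 /= bilinDl // bilinZl.
Qed.

Lemma tens_sum s : tens s = \sum_(xy <- s) pure xy.1 xy.2.
Proof.
elim: s => [|[x y] s IHs]; first by rewrite big_nil.
by rewrite big_cons -IHs [RHS]tensDE.
Qed.

Lemma tensor_universal (M : lmodType R) (b : A -> B -> M) : bilinear_map b ->
  exists! g : tensor -> M, linear g /\ forall x y, g (pure x y) = b x y.
Proof.
move=> bb; exists (fun u => tsum b (tlist u)); split.
  split=> [r|x y]; last by rewrite tsum_list // /tsum big_seq1.
  elim/tensW => s; elim/tensW => t; rewrite [_ *: _]tensZE [X in tlist X]tensDE.
  by rewrite !tsum_list // tsumD tsumZ.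
move=> g [lg gb]; apply/funext; elim/tensW => s; rewrite tsum_list // tens_sum.
have g0 : g 0 = 0.
  by have := lg (-1) 0 0; rewrite !scaleN1r oppr0 addr0 addNr.
have gD u v : g (u + v) = g u + g v by have := lg 1 u v; rewrite !scale1r.
rewrite (big_morph g gD g0) /tsum; apply: eq_bigr => xy _; exact/esym/gb.
Qed.

Lemma pureM x x' y y' : pure x y * pure x' y' = pure (x * x') (y * y').
Proof. exact: tensME. Qed.

End TensorProduct.

Definition projective (S : pzRingType) (P : lmodType S) : Prop :=
  forall (M N : lmodType S) (g : {linear M -> N}) (f : {linear P -> N}),
    (forall y, exists x, g x = y) ->
    exists h : {linear P -> M}, forall x, g (h x) = f x.

(* The ring A seen as a module over A (x) A, with (a (x) b) . c = a b c. *)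
Definition env_module (R : comNzRingType) (A : comAlgType R) : Type := A.

Section EnvModule.
Variables (R : comNzRingType) (A : comAlgType R).

HB.instance Definition _ := GRing.Zmodule.on (env_module A).

Definition env_scale (u : tensor A A) (c : env_module A) : env_module A :=
  tsum (fun a b : A => a * b) (tlist u) * c.

Lemma mul_bilinear : bilinear_map (fun a b : A => a * b).
Proof.
split=> x r u v; first by rewrite mulrDr scalerAr.
by rewrite mulrDl scalerAl.
Qed.

Lemma env_scale_tens s c : env_scale (tens s) c =
  (\sum_(ab <- s) ab.1 * ab.2) * (c : A).
Proof. by rewrite /env_scale tsum_list //; exact: mul_bilinear. Qed.

Let tensW (P : tensor A A -> Prop) : (forall s, P (tens s)) -> forall u, P u.
Proof. by move=> Ps u; rewrite -(tlistK u). Qed.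

Lemma env_scaleA u v c : env_scale u (env_scale v c) = env_scale (u * v) c.
Proof.
elim/tensW: u => s; elim/tensW: v => t; rewrite [(_ * _)%R]tensME.
rewrite !env_scale_tens mulrA /tmul big_allpairs_dep /= mulr_suml; congr (_ * _).
apply: eq_bigr => x _; rewrite mulr_sumr; apply: eq_bigr => y _.
by rewrite mulrACA.
Qed.

Lemma env_scale1 : left_id 1 env_scale.
Proof.
by move=> c; rewrite [LHS]env_scale_tens big_seq1 !mul1r.
Qed.

Lemma env_scaleDr : right_distributive env_scale +%R.
Proof. by move=> u c c'; rewrite /env_scale mulrDr. Qed.

Lemma env_scaleDl c : {morph env_scale^~ c : u v / u + v}.
Proof.
elim/tensW => s; elim/tensW => t; rewrite [(_ + _)%R]tensDE.
by rewrite !env_scale_tens big_cat mulrDl.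
Qed.

HB.instance Definition _ := GRing.Zmodule_isLmodule.Build (tensor A A)
  (env_module A) env_scaleA env_scale1 env_scaleDr env_scaleDl.

End EnvModule.

Definition separable_algebra (R : comNzRingType) (A : comAlgType R) : Prop :=
  projective (env_module A).

(* {poly %/ f} is R[x]/(f) only when f is monic of positive degree. *)
Definition separable_polynomial (R : comNzRingType) (f : {poly R}) : Prop :=
  separable_algebra {poly %/ f}.

Section PadicIntegers.
Variable p : nat.

(* Residues are indexed from p ^ 1 since 'Z_1 is not the zero ring; for p > 1
   the factor 'Z_(p ^ k.+1) is Z/p^(k+1)Z, while for p <= 1 all factors are
   'Z_2, a junk value. *)
Definition residues := forall k : nat, 'Z_(p ^ k.+1).

Definition zp_red k (a : 'Z_(p ^ k.+2)) : 'Z_(p ^ k.+1) := inZp a.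

Definition coherent (x : residues) : bool :=
  `[< forall k, zp_red (x k.+1) = x k >].

Record padic_int := PadicInt {
  zp_res :> forall k : nat, 'Z_(p ^ k.+1);
  _ : coherent zp_res
}.
HB.instance Definition _ := [isSub for zp_res].
HB.instance Definition _ := gen_eqMixin padic_int.
HB.instance Definition _ := gen_choiceMixin padic_int.

Lemma zp_redK (x : padic_int) k : zp_red (x k.+1) = x k.
Proof. by case: x => /= x cx; move/asboolP: cx => /(_ k). Qed.

Lemma padicP (x y : padic_int) : (forall k, x k = y k) -> x = y.
Proof. by move=> xy; apply/val_inj/functional_extensionality_dep. Qed.

Fact Zp_modulus_dvd k :
  ((Zp_trunc (p ^ k.+1)).+2 %| (Zp_trunc (p ^ k.+2)).+2)%N.
Proof.
have [p1|p1] := leqP p 1.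
  by case: p p1 => [|[|//]] _; rewrite ?exp0n ?exp1n.
by rewrite !Zp_cast ?dvdn_exp2l // -(expn0 p) ltn_exp2l.
Qed.

Lemma zp_redD k : {morph @zp_red k : a b / a + b}.
Proof.
move=> a b; apply/val_inj => /=.
by rewrite modn_dvdm ?Zp_modulus_dvd // modnDm.
Qed.

Lemma zp_redM k : {morph @zp_red k : a b / a * b}.
Proof.
move=> a b; apply/val_inj => /=.
by rewrite modn_dvdm ?Zp_modulus_dvd // modnMm.
Qed.

Lemma zp_red0 k : zp_red (0 : 'Z_(p ^ k.+2)) = 0.
Proof. by apply/val_inj; rewrite /= mod0n. Qed.

Lemma zp_red1 k : zp_red (1 : 'Z_(p ^ k.+2)) = 1.
Proof. by apply/val_inj. Qed.

Lemma zp_redN k : {morph @zp_red k : a / - a}.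
Proof.
by move=> a; apply: (addrI (zp_red a)); rewrite -zp_redD !subrr zp_red0.
Qed.

Fact coherent0 : coherent (fun=> 0).
Proof. by apply/asboolP => k; exact: zp_red0. Qed.
Fact coherent1 : coherent (fun=> 1).
Proof. by apply/asboolP => k; exact: zp_red1. Qed.
Fact coherentD (x y : padic_int) : coherent (fun k => x k + y k).
Proof. by apply/asboolP => k; rewrite zp_redD !zp_redK. Qed.
Fact coherentM (x y : padic_int) : coherent (fun k => x k * y k).
Proof. by apply/asboolP => k; rewrite zp_redM !zp_redK. Qed.
Fact coherentN (x : padic_int) : coherent (fun k => - x k).
Proof. by apply/asboolP => k; rewrite zp_redN !zp_redK. Qed.

Definition padic0 := PadicInt coherent0.
Definition padic1 := PadicInt coherent1.
Definition padicD x y := PadicInt (coherentD x y).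
Definition padicM x y := PadicInt (coherentM x y).
Definition padicN x := PadicInt (coherentN x).

Fact padicDA : associative padicD.
Proof. by move=> x y z; apply: padicP => k /=; rewrite addrA. Qed.
Fact padicDC : commutative padicD.
Proof. by move=> x y; apply: padicP => k /=; rewrite addrC. Qed.
Fact padic0D : left_id padic0 padicD.
Proof. by move=> x; apply: padicP => k /=; rewrite add0r. Qed.
Fact padicND : left_inverse padic0 padicN padicD.
Proof. by move=> x; apply: padicP => k /=; rewrite addNr. Qed.

HB.instance Definition _ :=
  GRing.isZmodule.Build padic_int padicDA padicDC padic0D padicND.

Fact padicMA : associative padicM.
Proof. by move=> x y z; apply: padicP => k /=; rewrite mulrA. Qed.
Fact padicMC : commutative padicM.
Proof. by move=> x y; apply: padicP => k /=; rewrite mulrC. Qed.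
Fact padic1M : left_id padic1 padicM.
Proof. by move=> x; apply: padicP => k /=; rewrite mul1r. Qed.
Fact padicMDl : left_distributive padicM padicD.
Proof. by move=> x y z; apply: padicP => k /=; rewrite mulrDl. Qed.
Fact padic1_neq0 : padic1 != padic0.
Proof.
apply/eqP => /(congr1 (fun x : padic_int => x 0%N)) /= /eqP.
by rewrite oner_eq0.
Qed.

HB.instance Definition _ := GRing.Zmodule_isComNzRing.Build padic_int
  padicMA padicMC padic1M padicMDl padic1_neq0.
HB.instance Definition _ := isPointed.Build padic_int 0.

(* The inverse limit topology: since residues mod p^(k+1) determine all lower
   ones, the sets of points with a prescribed k-th residue form a base. *)
Definition padic_open (U : set padic_int) : Prop :=
  forall x, U x -> exists k, forall y : padic_int, y k = x k -> U y.

Lemma zp_res_le (x y : padic_int) j k : (j <= k)%N -> x k = y k -> x j = y j.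
Proof.
elim: k => [|k IHk]; first by rewrite leqn0 => /eqP->.
rewrite leq_eqVlt => /predU1P[->//|jk xy]; apply: IHk => //.
by rewrite -(zp_redK x) -(zp_redK y) xy.
Qed.

Fact padic_openT : padic_open setT.
Proof. by move=> x _; exists 0%N. Qed.

Fact padic_openI : setI_closed padic_open.
Proof.
move=> U V oU oV x [/oU[j Uj] /oV[k Vk]]; exists (maxn j k) => y yx.
by split; [apply: Uj|apply: Vk]; apply: zp_res_le yx;
  rewrite ?leq_maxl ?leq_maxr.
Qed.

Fact padic_open_bigU (I : Type) (F : I -> set padic_int) :
  (forall i, padic_open (F i)) -> padic_open (\bigcup_i F i).
Proof.
by move=> oF x [i _ /oF[k Fk]]; exists k => y /Fk; exists i.
Qed.

HB.instance Definition _ := isOpenTopological.Build padic_int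
  padic_openT padic_openI padic_open_bigU.

Definition padic_borel : set (set padic_int) := <<s @open padic_int >>.

HB.instance Definition _ :=
  @isMeasurable.Build (sigma_display (@open padic_int)) padic_int padic_borel
    (@sigma_algebra0 _ setT _) (@sigma_algebraC _ _)
    (@sigma_algebra_bigcup _ setT _).

End PadicIntegers.

(* For a probability measure on the Borel sets of the compact metrizable group
   padic_int p, translation invariance is the whole content of being the Haar
   measure of total mass 1, regularity being automatic. *)
Definition is_haar (p : nat) (R : realType)
    (mu : probability (padic_int p) R) : Prop :=
  forall (a : padic_int p) (U : set (padic_int p)), measurable U ->
    mu [set a + x | x in U] = mu U.

Section PowerMeasure.
Context d (T : measurableType d) (R : realType).
Variable mu : probability T R.

Definition tuple_cons n (xt : T * n.-tuple T) : n.+1.-tuple T :=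
  [tuple of xt.1 :: xt.2].

Lemma measurable_tuple_cons n : measurable_fun setT (@tuple_cons n).
Proof.
by apply: measurable_cons; [exact: measurable_fst|exact: measurable_snd].
Qed.

HB.instance Definition _ n :=
  isMeasurableFun.Build _ _ _ _ (@tuple_cons n) (@measurable_tuple_cons n).

Fixpoint power_measure (n : nat) : probability (n.-tuple T) R :=
  match n with
  | 0 => \d_([tuple] : 0.-tuple T)
  | n'.+1 => distribution (mu \x power_measure n')%E (@tuple_cons n')
  end.

Lemma power_measure_box n (A : 'I_n -> set T) : (forall i, measurable (A i)) ->
  power_measure n [set t | forall i, A i (tnth t i)] = (\prod_(i < n) mu (A i))%E.
Proof.
elim: n A => [|n IHn] A mA.
  by rewrite big_ord0 /= diracE mem_set // => -[].
rewrite big_ord_recl /= /distribution /pushforward -IHn //=.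
rewrite -product_measure1E //=; last first.
  rewrite (_ : [set t | _] = \bigcap_(i in [set: 'I_n])
      ((@tnth n T)^~ i @^-1` A (lift ord0 i))).
    apply: fin_bigcap_measurable => // i _; rewrite -[X in measurable X]setTI.
    exact: measurable_tnth.
  by apply/seteqP; split => t /= At i; [move=> _; exact: At|exact: (At i I)].
congr (product_measure1 _ _ _); apply/seteqP; split => -[x t] /=.
  move=> At; split=> [|i]; first by have := At ord0; rewrite tnth0.
  by have := At (lift ord0 i); rewrite tnthS.
move=> [Ax At] i; case: (unliftP ord0 i) => [j|] ->.
  by rewrite tnthS; exact: At.
by rewrite tnth0.
Qed.

End PowerMeasure.

Section SeparableMonic.
Variables (A : comNzRingType) (d : nat).

Definition monic_of_coefs (a : d.-tuple A) : {poly A} :=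
  'X^d + \poly_(i < d) a`_i.

Definition separable_monic : set {poly A} :=
  [set f | [/\ f \is monic, size f = d.+1 & separable_polynomial f]].

End SeparableMonic.

(* Main.v *)
Require Import Defs.
From HB Require Import structures.
From mathcomp Require Import all_boot all_order all_algebra all_field.
From mathcomp Require Import qpoly separable ring.
From mathcomp Require Import all_classical all_reals all_analysis.

(** Separability of a monic polynomial over [Z_p] only depends on its
    reduction modulo [p], so the probability is a proportion of polynomials
    over [F_p].

    An algebra [A] is separable over [R] exactly when [A (x) A] contains an
    element [e] of product 1 on which left and right multiplication by [A]
    agree ([separable_algebraP]).  Given such an [e], every derivation of [A]
    vanishes.  Applied to [A = R[x]/f] and to the derivation that sends a
    polynomial to its derivative modulo a common divisor [G] of the reductions
    of [f] and [f'] to a field, this says that 1, the image of [x], is zero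
    modulo [G], so that [G] is constant ([separable_polynomial_reduce]).
    Conversely, if the reductions of [f] and [f'] are coprime and the reduction
    map is local, then multiplication by [f'] on [R[x]/f] has an invertible
    determinant, hence [v f' = 1] for some [v] ([coprimep_lift]); the element
    [e] is then [v] times the Bezoutian [(f(x (x) 1) - f(1 (x) x)) /
    (x (x) 1 - 1 (x) x)], whose product is [f'].

    Over a finite field with [q] elements a monic polynomial is uniquely
    [a^2 b] with [a], [b] monic and [b] separable.  It is inseparable iff
    [a] is not 1, that is, [a = a1 X + c] with [a1] monic, so
    [(c, a1^2 b) |-> (a1 X + c)^2 b] is a bijection from pairs of a scalar and
    a monic polynomial of degree [n - 2] to the inseparable monic polynomials of
    degree [n]: there are [q^(n - 1)] of them ([card_inseparable]).

    Finally, translation invariance gives each of the [p] residue classes of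
    [Z_p] the measure [1/p] ([haar_residue_class]), and the set of separable
    polynomials is the disjoint union of [p^d - p^(d - 1)] products of [d] such
    classes. *)

Set Implicit Arguments.
Unset Strict Implicit.
Unset Printing Implicit Defensive.
Import Order.TTheory GRing.Theory Num.Theory.
Import Pdiv.CommonRing Pdiv.RingMonic.
Local Open Scope ring_scope.

(** * Separability idempotents *)

Section SeparabilityIdempotent.
Variables (R : comNzRingType) (A : comAlgType R).

Lemma tensor_ind (P : tensor A A -> Prop) :
  (forall s, P (tens s)) -> forall u, P u.
Proof. by move=> Ps u; rewrite -(tlistK u). Qed.

Definition tensor_mul (u : tensor A A) : A :=
  tsum (fun a b : A => a * b) (tlist u).

Lemma tensor_mul_tens s :
  tensor_mul (tens s) = \sum_(xy <- s) xy.1 * xy.2.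
Proof. exact/tsum_list/mul_bilinear. Qed.

Lemma tensor_mul_pure a b : tensor_mul (pure a b) = a * b.
Proof. by rewrite tensor_mul_tens big_seq1. Qed.

Lemma tensor_mulE u : tensor_mul u = u *: (1 : env_module A).
Proof. exact/esym/mulr1. Qed.

Fact tensor_mul_linear : linear tensor_mul.
Proof.
move=> r; elim/tensor_ind => s; elim/tensor_ind => t.
rewrite [_ *: _]tensZE [X in tensor_mul X]tensDE !tensor_mul_tens.
by rewrite big_cat big_map scaler_sumr; under eq_bigr do rewrite /= -scalerAl.
Qed.
HB.instance Definition _ :=
  GRing.isSemilinear.Build R (tensor A A) A _ tensor_mul
    (GRing.semilinear_linear tensor_mul_linear).

Fact tensor_mul_monoid_morphism : monoid_morphism tensor_mul.
Proof.
split=> [|u v]; first by rewrite tensor_mul_tens big_seq1 mulr1.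
by rewrite tensor_mulE -scalerA -[v *: _]tensor_mulE.
Qed.
HB.instance Definition _ :=
  GRing.isMonoidMorphism.Build (tensor A A) A tensor_mul
    tensor_mul_monoid_morphism.

Definition tensl (a : A) : tensor A A := pure a 1.
Definition tensr (b : A) : tensor A A := pure 1 b.

Fact tensl_linear : linear tensl.
Proof. by have [_ ] := pure_bilinear A A; exact. Qed.
Fact tensr_linear : linear tensr.
Proof. by have [+ _] := pure_bilinear A A; exact. Qed.
Fact tensl_monoid_morphism : monoid_morphism tensl.
Proof. by split=> // a b; rewrite /tensl pureM mulr1. Qed.
Fact tensr_monoid_morphism : monoid_morphism tensr.
Proof. by split=> // a b; rewrite /tensr pureM mulr1. Qed.
HB.instance Definition _ := GRing.isSemilinear.Build R A (tensor A A) _ tensl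
  (GRing.semilinear_linear tensl_linear).
HB.instance Definition _ := GRing.isSemilinear.Build R A (tensor A A) _ tensr
  (GRing.semilinear_linear tensr_linear).
HB.instance Definition _ :=
  GRing.isMonoidMorphism.Build A (tensor A A) tensl tensl_monoid_morphism.
HB.instance Definition _ :=
  GRing.isMonoidMorphism.Build A (tensor A A) tensr tensr_monoid_morphism.

Lemma tensor_mull a : tensor_mul (tensl a) = a.
Proof. by rewrite tensor_mul_pure mulr1. Qed.

Lemma tensor_mulr a : tensor_mul (tensr a) = a.
Proof. by rewrite tensor_mul_pure mul1r. Qed.

Lemma pure_tensl_tensr a b : pure a b = tensl a * tensr b.
Proof. by rewrite pureM mulr1 mul1r. Qed.

Lemma tensor_scaleE (r : R) u : r *: u = tensl r%:A * u.
Proof.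
elim/tensor_ind: u => s; rewrite [LHS]tensZE [RHS]tensME.
apply/tensP => M b bb; rewrite tsumZ // tsumM // big_seq1 scaler_sumr.
by apply: eq_bigr => xy _; rewrite /= -scalerAl !mul1r (bilinZl bb).
Qed.

Lemma tensor_scaleAr (r : R) (u v : tensor A A) : u * (r *: v) = r *: (u * v).
Proof. by rewrite !tensor_scaleE mulrCA. Qed.

(** The regular module structure on the domain makes this the linear map, out of
    the free module of rank one, that sends 1 to [m]. *)
Definition env_orbit (M : lmodType (tensor A A)) (m : M) (u : (tensor A A)^o) :=
  u *: m.

Fact env_orbit_linear (M : lmodType (tensor A A)) (m : M) : linear (env_orbit m).
Proof. by move=> r u v; rewrite /env_orbit scalerDl scalerA. Qed.
HB.instance Definition _ (M : lmodType (tensor A A)) (m : M) :=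
  GRing.isSemilinear.Build (tensor A A) (tensor A A)^o M _ (env_orbit m)
    (GRing.semilinear_linear (env_orbit_linear m)).

Definition separability_idempotent (e : tensor A A) : Prop :=
  tensor_mul e = 1 /\ forall a : A, tensl a * e = tensr a * e.

(** If [A] is projective, a section of the product map [A (x) A -> A] sends 1 to
    such an [e].  Conversely [a |-> (a (x) 1) e] is a section, and composing it
    with a lift [m0] of the image of 1 solves every lifting problem. *)
Lemma separable_algebraP :
  separable_algebra A <-> exists e, separability_idempotent e.
Proof.
split=> [projA|[e [mul_e comm_e]] M N g f g_onto].
  have [y|h hE] := projA _ _ (env_orbit (1 : env_module A)) idfun.
    by exists (tensl y); rewrite /= /env_orbit -tensor_mulE tensor_mull.
  exists (h 1); split=> [|a]; first by rewrite tensor_mulE [LHS]hE.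
  rewrite -[LHS]/(tensl a *: h 1) -[RHS]/(tensr a *: h 1) -!linearZ /=.
  by rewrite -!tensor_mulE tensor_mull tensor_mulr.
have [m0 gm0] := g_onto (f 1).
pose h (a : env_module A) : M := (tensl a * e) *: m0.
(* Since [e] does not see the side, [u e] only depends on the product of [u]. *)
have slide u : u * e = tensl (tensor_mul u) * e.
  elim/tensor_ind: u => s; rewrite tensor_mul_tens tens_sum linear_sum /=.
  rewrite !mulr_suml; apply: eq_bigr => -[x y] _ /=.
  by rewrite pure_tensl_tensr rmorphM -!mulrA comm_e.
have hlin : linear h.
  move=> u a b; rewrite /h.
  have -> : tensl (u *: a + b : env_module A) =
      tensl (tensor_mul u) * tensl a + tensl b by rewrite -rmorphM -raddfD.
  by rewrite mulrDl scalerDl mulrAC -slide mulrAC -mulrA scalerA.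
pose hL : {linear env_module A -> M} := HB.pack h (GRing.isSemilinear.Build
  (tensor A A) (env_module A) M _ h (GRing.semilinear_linear hlin)).
exists hL => a; rewrite /= /h linearZ /= gm0 -linearZ /=; congr (f _).
by rewrite -tensor_mulE rmorphM /= tensor_mull mul_e mulr1.
Qed.

End SeparabilityIdempotent.

(** * Reduction of a separable polynomial to a field *)

Lemma mk_monic_id (R : nzRingType) (f : {poly R}) :
  f \is monic -> (1 < size f)%N -> mk_monic f = f.
Proof. by rewrite /mk_monic => -> ->. Qed.

(** Bilinear maps over [R] out of the tensor square have to land in an
    [R]-module, whereas polynomials over [k] form a [k]-module. *)
Definition restrict_scalars (R : comNzRingType) (k : comNzRingType)
  (phi : {rmorphism R -> k}) (V : lmodType k) : Type := V.

Section RestrictScalars.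
Variables (R k : comNzRingType) (phi : {rmorphism R -> k}) (V : lmodType k).
Local Notation W := (restrict_scalars phi V).
HB.instance Definition _ := GRing.Zmodule.on W.
Definition restrict_scale (r : R) (v : W) : W := phi r *: (v : V).
Fact restrict_scaleA a b v :
  restrict_scale a (restrict_scale b v) = restrict_scale (a * b) v.
Proof. by rewrite /restrict_scale scalerA rmorphM. Qed.
Fact restrict_scale1 : left_id 1 restrict_scale.
Proof. by move=> v; rewrite /restrict_scale rmorph1 scale1r. Qed.
Fact restrict_scaleDr : right_distributive restrict_scale +%R.
Proof. by move=> a u v; exact: scalerDr. Qed.
Fact restrict_scaleDl v : {morph restrict_scale^~ v : a b / a + b}.
Proof. by move=> a b; rewrite /restrict_scale rmorphD scalerDl. Qed.
HB.instance Definition _ := GRing.Zmodule_isLmodule.Build R W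
  restrict_scaleA restrict_scale1 restrict_scaleDr restrict_scaleDl.
End RestrictScalars.

Lemma qpoly_mulE (R : comNzRingType) (f : {poly R}) (u v : {poly %/ f}) :
  f \is monic -> (1 < size f)%N ->
  u * v = rmodp ((u : {poly R}) * (v : {poly R})) f :> {poly R}.
Proof.
by move=> f_monic f_gt1; rewrite poly_of_qpolyM; congr rmodp; exact: mk_monic_id.
Qed.

Lemma in_qpolyE (R : comNzRingType) (f q : {poly R}) :
  f \is monic -> (1 < size f)%N -> in_qpoly f q = rmodp q f :> {poly R}.
Proof. by move=> f_monic f_gt1; rewrite /= mk_monic_id. Qed.

Section Reduction.
Variables (R : comNzRingType) (k : fieldType) (phi : {rmorphism R -> k}).
Variable f : {poly R}.
Hypotheses (f_monic : f \is monic) (f_gt1 : (1 < size f)%N).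
Local Notation "q ^phi" := (map_poly phi q) (at level 2, format "q ^phi").

Lemma map_rmodp w : (rmodp w f)^phi = w^phi %% f^phi.
Proof.
have F_monic : f^phi \is monic by rewrite monic_map.
have sz : (size (rmodp w f)^phi < size f^phi)%N.
  rewrite [leqRHS]size_map_poly_id0; last first.
    by rewrite (eqP f_monic) rmorph1 oner_neq0.
  by apply: leq_ltn_trans (size_poly _ _) _; rewrite ltn_rmodpN0 ?monic_neq0.
rewrite [in RHS](rdivp_eq f_monic w) rmorphD rmorphM /=.
by rewrite modpD modp_mull add0r modp_small.
Qed.

(** The derivation is only used through the bilinear map [b u v = u v'] modulo
    [G], the gcd of the reductions of [f] and [f'].  It is well defined on
    [R[x]/f] because [G] divides both.  Evaluating [b] on the equality of
    [(x (x) 1) e] and [(1 (x) x) e], the terms [x u v'] cancel by the Leibniz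
    rule and the sum of the [u v], which is 1, is left. *)
Lemma separable_polynomial_reduce :
  separable_polynomial f -> separable_poly f^phi.
Proof.
move=> /separable_algebraP[e [mul_e comm_e]].
rewrite separable_poly.unlock /coprimep; set G := gcdp _ _.
have [GF GF'] : G %| f^phi /\ G %| (f^phi)^`().
  by rewrite dvdp_gcdl dvdp_gcdr.
have eq_modG (u v q : {poly k}) : u = v + q * f^phi ->
    u %% G = v %% G /\ u^`() %% G = v^`() %% G.
  move=> ->; rewrite derivD derivM !modpD.
  have /modp_eq0 -> : G %| q * f^phi by rewrite dvdp_mull.
  have /modp_eq0 -> : G %| q^`() * f^phi by rewrite dvdp_mull.
  have /modp_eq0 -> : G %| q * (f^phi)^`() by rewrite dvdp_mull.
  by rewrite !addr0.
have modM (p q q' : {poly k}) :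
    q %% G = q' %% G -> (p * q) %% G = (p * q') %% G.
  by move=> eqq; rewrite -modp_mul eqq modp_mul.
pose red (u : {poly %/ f}) : {poly k} := (u : {poly R})^phi.
have redD r u v : red (r *: u + v) = phi r *: red u + red v.
  by rewrite /red /= rmorphD /= linearZ.
have redM u v : red (u * v) %% G = (red u * red v) %% G /\
    (red (u * v))^`() %% G = (red u * red v)^`() %% G.
  apply: (eq_modG _ _ (- ((red u * red v) %/ f^phi))).
  rewrite {1}/red qpoly_mulE // map_rmodp rmorphM /=.
  by rewrite mulNr [X in _ = X - _](divp_eq _ f^phi) addrC addKr.
pose W := restrict_scalars phi {poly k}.
pose b (u v : {poly %/ f}) : W := (red u * (red v)^`()) %% G.
have bb : bilinear_map b.
  split=> x r u v; rewrite /b redD.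
    by rewrite derivD derivZ mulrDr -scalerAr modpD modpZl.
  by rewrite mulrDl -scalerAl modpD modpZl.
pose x : {poly %/ f} := in_qpoly f 'X.
have [_] : red x %% G = 'X %% G /\ (red x)^`() %% G = ('X)^`() %% G.
  apply: (eq_modG _ _ (- ('X %/ f^phi))).
  rewrite /red in_qpolyE // map_rmodp map_polyX mulNr.
  by rewrite [X in _ = X - _](divp_eq _ f^phi) addrC addKr.
rewrite derivX => dx.
have leibniz u v : b (x * u) v - b u (x * v) = - ((red u * red v) %% G).
  have [[xu _] [_ xv]] := (redM x u, redM x v).
  rewrite /b [red (x * u) * _]mulrC (modM _ _ _ xu) (modM _ _ _ xv) derivM.
  have -> : red u * ((red x)^`() * red v + red x * (red v)^`()) =
      red u * red v * (red x)^`() + (red v)^`() * (red x * red u) by ring.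
  rewrite modpD (modM _ _ _ dx) mulr1 [X in _ - X]addrC opprD addrA.
  by rewrite subrr add0r.
have := comm_e x; rewrite -(tlistK e) [LHS]tensME [RHS]tensME.
move=> /tensP/(_ W b bb).
rewrite !tsumM // !big_seq1 /=.
under eq_bigr do rewrite mul1r.
under [RHS]eq_bigr do rewrite mul1r.
move=> /eqP; rewrite -subr_eq0 -sumrB; under eq_bigr do rewrite leibniz.
rewrite sumrN oppr_eq0 => /eqP sum0.
have red0 : red 0 = 0 by rewrite /red rmorph0.
have redS u v : red (u + v) = red u + red v.
  by have := redD 1 u v; rewrite rmorph1 !scale1r.
have : (1 : {poly k}) %% G = 0.
  rewrite -sum0.
  have -> : (1 : {poly k}) = \sum_(uv <- tlist e) red (uv.1 * uv.2).
    rewrite -(big_morph red redS red0) -tensor_mul_tens tlistK mul_e.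
    exact/esym/(rmorph1 (map_poly phi)).
  rewrite (big_morph (fun q => q %% G) (fun u v => modpD G u v) (mod0p G)).
  by apply: eq_bigr => uv _; case: (redM uv.1 uv.2).
by move=> /modp_eq0P; rewrite dvdp1.
Qed.
End Reduction.

(** * Lifting coprimality along a local morphism *)

Section Bezoutian.
Variables (R : comNzRingType) (f : {poly R}).
Hypotheses (f_monic : f \is monic) (f_gt1 : (1 < size f)%N).
Local Notation A := {poly %/ f}.
Local Notation x := (in_qpoly f 'X : A).

Lemma in_qpoly_id : in_qpoly f f = 0.
Proof. by apply/val_inj; rewrite /= mk_monic_id // rmodpp. Qed.

Lemma in_qpoly_sum (q : {poly R}) :
  in_qpoly f q = \sum_(i < size q) q`_i *: x ^+ i.
Proof.
rewrite -{1}[q]coefK poly_def linear_sum; apply: eq_bigr => i _.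
by rewrite linearZ /= rmorphXn.
Qed.

Lemma in_qpoly_surj (a : A) : exists q : {poly R}, a = in_qpoly f q.
Proof.
exists (a : {poly R}); apply/val_inj/esym/rmodp_small.
exact: size_mk_monic.
Qed.

(** This is [(f(y) - f(z)) / (y - z)] at [y = x (x) 1] and [z = 1 (x) x],
    expanded monomial by monomial since the tensor square has no division. *)
Definition bezoutian : tensor A A :=
  \sum_(n < size f) f`_n *:
    \sum_(i < n) tensl x ^+ (n.-1 - i) * tensr x ^+ i.

(** Multiplying by [x (x) 1 - 1 (x) x] gives [f(x) (x) 1 - 1 (x) f(x) = 0], and
    [x] generates the algebra. *)
Lemma bezoutian_comm a : tensl a * bezoutian = tensr a * bezoutian.
Proof.
have comm_x : tensl x * bezoutian = tensr x * bezoutian.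
  apply/eqP; rewrite -subr_eq0 -mulrBl /bezoutian mulr_sumr.
  under eq_bigr do rewrite tensor_scaleAr -subrXX scalerBr -!rmorphXn -!linearZ.
  by rewrite sumrB -!linear_sum -poly_def coefK /= in_qpoly_id !linear0 addr0.
have [q ->] := in_qpoly_surj a; rewrite in_qpoly_sum !linear_sum !mulr_suml /=.
apply: eq_bigr => i _; rewrite !linearZ /= ![_ * bezoutian]mulrC.
rewrite !tensor_scaleAr !rmorphXn; congr (_ *: _).
rewrite ![bezoutian * _]mulrC; elim: (i : nat) => [|n IHn].
  by rewrite !mul1r.
by rewrite exprSr -mulrA comm_x mulrCA IHn mulrA -exprS.
Qed.

(** On the diagonal [y = z = x], [y^(n - 1 - i) z^i] becomes [x^(n - 1)] for each of the
    [n] values of [i]. *)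
Lemma tensor_mul_bezoutian : tensor_mul bezoutian = in_qpoly f f^`().
Proof.
have -> : f^`() = \sum_(n < size f) f`_n *: ('X^n)^`().
  rewrite -{1}[f]coefK poly_def linear_sum.
  by apply: eq_bigr => i _; exact: linearZ.
rewrite /bezoutian [LHS]linear_sum [RHS]linear_sum /=; apply: eq_bigr => n _.
rewrite [LHS]linearZ [RHS]linearZ; congr (_ *: _).
rewrite derivXn [LHS]linear_sum [RHS]raddfMn /= [in RHS]rmorphXn /=.
rewrite (eq_bigr (fun=> x ^+ n.-1)) ?sumr_const ?card_ord // => i _.
rewrite rmorphM !rmorphXn /= tensor_mull tensor_mulr -exprD subnK //.
by rewrite -ltnS prednK // (leq_ltn_trans _ (ltn_ord i)).
Qed.

Lemma separable_polynomial_deriv (v : A) :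
  v * in_qpoly f f^`() = 1 -> separable_polynomial f.
Proof.
move=> vf'; apply/separable_algebraP; exists (tensl v * bezoutian); split.
  by rewrite rmorphM /= tensor_mull tensor_mul_bezoutian.
by move=> a; rewrite mulrCA bezoutian_comm mulrCA.
Qed.
End Bezoutian.

Section UnitLifting.
Variables (R : comNzRingType) (k : fieldType) (phi : {rmorphism R -> k}).
Hypothesis phi_local : forall r, phi r != 0 -> exists s, s * r = 1.
Variable f : {poly R}.
Hypotheses (f_monic : f \is monic) (f_gt1 : (1 < size f)%N).
Local Notation "q ^phi" := (map_poly phi q) (at level 2, format "q ^phi").
Local Notation d := (size f).-1.

Definition modmul_mx (g : {poly R}) : 'M[R]_d :=
  \matrix_i poly_rV (rmodp ('X^i * g) f).

Lemma rVpoly_sum (S : nzRingType) n (w : 'rV[S]_n) :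
  rVpoly w = \sum_i w 0 i *: 'X^i.
Proof.
rewrite {1}[w]row_sum_delta linear_sum; apply: eq_bigr => i _.
by rewrite linearZ /= rVpoly_delta.
Qed.

Lemma rVpoly_row_modmul_mx g i :
  rVpoly (row i (modmul_mx g)) = rmodp ('X^i * g) f.
Proof.
rewrite rowK poly_rV_K // -ltnS prednK; last exact: ltnW.
by rewrite ltn_rmodpN0 ?monic_neq0.
Qed.

Lemma mul_modmul_mx g (w : 'rV_d) :
  rVpoly (w *m modmul_mx g) = rmodp (rVpoly w * g) f.
Proof.
rewrite mulmx_sum_row linear_sum rVpoly_sum mulr_suml rmodp_sum //.
apply: eq_bigr => i _; rewrite linearZ /= rVpoly_row_modmul_mx.
by rewrite -scalerAl rmodpZ.
Qed.

Lemma map_modmul_mx g (w : 'rV_d) :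
  rVpoly (w *m map_mx phi (modmul_mx g)) = (rVpoly w * g^phi) %% f^phi.
Proof.
rewrite mulmx_sum_row linear_sum [in RHS]rVpoly_sum mulr_suml.
rewrite (big_morph (fun q => q %% f^phi) (id1 := 0) (op1 := +%R)) ?mod0p //;
  last by move=> u v; exact: modpD.
apply: eq_bigr => i _; rewrite linearZ /= -map_row -map_rVpoly.
rewrite rVpoly_row_modmul_mx map_rmodp // rmorphM /= map_polyXn.
by rewrite -scalerAl modpZl.
Qed.

(** Over the field, [G] coprime to [F] acts injectively on polynomials modulo
    [F], so the determinant of the multiplication matrix of [g] does not vanish
    in [k].  It is then invertible in [R], and Cramer's rule gives a vector that
    the matrix sends to 1. *)
Lemma coprimep_lift g : coprimep f^phi g^phi ->
  exists v : {poly %/ f}, v * in_qpoly f g = 1.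
Proof.
move=> co_fg.
have /phi_local[s sB] : phi (\det (modmul_mx g)) != 0.
  rewrite -det_map_mx; apply/det0P => -[w w0 wB].
  have F0 : f^phi != 0 by rewrite monic_neq0 ?monic_map.
  have := congr1 rVpoly wB; rewrite map_modmul_mx linear0 => /modp_eq0P.
  have wP0 : rVpoly w != 0.
    by apply: contra_neq w0 => wP0; rewrite -[w]rVpolyK wP0 linear0.
  rewrite Gauss_dvdpl // => /(dvdp_leq wP0).
  rewrite size_map_poly_id0; last by rewrite (eqP f_monic) rmorph1 oner_neq0.
  by rewrite leqNgt (leq_ltn_trans (size_poly _ _)) // prednK // ltnW.
pose w := poly_rV 1 *m (s *: \adj (modmul_mx g)).
exists (in_qpoly f (rVpoly w)); rewrite -rmorphM.
apply/val_inj; rewrite /= mk_monic_id // -mul_modmul_mx /w.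
rewrite -mulmxA -scalemxAl mul_adj_mx -mul_scalar_mx -scalar_mxM sB mulmx1.
by rewrite poly_rV_K // size_poly1; case: (size f) f_gt1 => [|[]].
Qed.

End UnitLifting.

Lemma separable_polynomialP (R : comNzRingType) (k : fieldType)
    (phi : {rmorphism R -> k})
    (phi_local : forall r, phi r != 0 -> exists s, s * r = 1) (f : {poly R}) :
  f \is monic -> (1 < size f)%N ->
  separable_polynomial f <-> separable_poly (map_poly phi f).
Proof.
move=> f_monic f_gt1; split; first exact: separable_polynomial_reduce.
rewrite separable_poly.unlock deriv_map.
case/(coprimep_lift phi_local f_monic f_gt1) => v; exact: separable_polynomial_deriv.
Qed.

(** * Counting separable polynomials over a finite field *)

Section MonicCoefs.
Variables (A : comNzRingType) (d : nat).
Implicit Types (a : d.-tuple A) (f : {poly A}).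

Lemma size_monic_of_coefs a : size (monic_of_coefs a) = d.+1.
Proof. by rewrite /monic_of_coefs size_polyDl ?size_polyXn // ltnS size_poly. Qed.

Lemma monic_of_coefs_monic a : monic_of_coefs a \is monic.
Proof.
by rewrite monicE lead_coefDl ?lead_coefXn // size_polyXn ltnS size_poly.
Qed.

Definition coefs_of f : d.-tuple A := [tuple f`_i | i < d].

Lemma monic_of_coefsK : cancel (@monic_of_coefs A d) coefs_of.
Proof.
move=> a; apply: eq_from_tnth => i.
rewrite tnth_mktuple /monic_of_coefs coefD coefXn coef_poly ltn_ord.
by rewrite (ltn_eqF (ltn_ord i)) add0r -tnth_nth.
Qed.

Lemma coefs_ofK f :
  f \is monic -> size f = d.+1 -> monic_of_coefs (coefs_of f) = f.
Proof.
move=> f_monic szf; apply/polyP => i; rewrite coefD coefXn coef_poly.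
case: ltngtP => [ltid|ltdi|->].
- by rewrite add0r -(tnth_nth 0 _ (Ordinal ltid)) tnth_mktuple.
- by rewrite addr0 nth_default // szf.
by rewrite addr0; move/monicP: f_monic; rewrite lead_coefE szf => ->.
Qed.
End MonicCoefs.

Section Perfect.
Variable k : finFieldType.
Implicit Types f g a b u : {poly k}.

(** Perfectness: a polynomial with zero derivative is one in ['X^p], and each of
    its coefficients is a [p]-th power because Frobenius is bijective. *)
Lemma deriv_eq0_expr u : u^`() = 0 ->
  exists v n, (1 < n)%N /\ u = v ^+ n.
Proof.
have [p p_prime pk] := finPcharP k.
move=> du; have [r _ rK] := injF_bij (fmorph_inj (pFrobenius_aut pk)).
have pkX : p \in [pchar {poly k}] by rewrite pchar_poly.
exists (\poly_(i < size u) r u`_(i * p)), p.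
split; first exact: prime_gt1.
rewrite poly_def -(pFrobenius_autE pkX) rmorph_sum.
have uE : u = (\poly_(i < size u) u`_(i * p)) \Po 'X^p.
  apply/polyP => i; rewrite coef_comp_poly_Xn ?prime_gt0 // coef_poly.
  have [pi|npi] := boolP (p %| i)%N.
    rewrite divnK //; case: ltnP => // szu; rewrite nth_default //.
    by rewrite (leq_trans szu) // leq_div.
  have := congr1 (fun q : {poly k} => q`_i.-1) du.
  have i_gt0 : (0 < i)%N by rewrite lt0n; apply: contraNneq npi => ->.
  rewrite coef_deriv prednK // coef0 => /eqP.
  by rewrite -mulr_natr mulf_eq0 -(dvdn_pcharf pk) (negPf npi) orbF => /eqP.
rewrite [LHS]uE poly_def linear_sum; apply: eq_bigr => i _ /=.
rewrite pFrobenius_autE exprZn comp_polyZ comp_Xn_poly -(pFrobenius_autE pk) rK.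
by rewrite -!exprM mulnC.
Qed.

(** Over an imperfect field the converse fails; here a factor with zero
    derivative would be a proper power, hence would contain a square. *)
Lemma separable_squarefree f :
  separable_poly f <-> (forall a, a ^+ 2 %| f -> size a == 1).
Proof.
split=> [sep_f a a2f|sqf].
  by apply: contraTT a2f => sza; rewrite separable_nosquare.
apply/separable_polyP; split.
  by apply/poly_square_freeP => u; apply: contraNN => /sqf.
move=> u uf u_gt1; apply/eqP => /deriv_eq0_expr[v [n [n_gt1 uE]]].
have /sqf/eqP v1 : v ^+ 2 %| f.
  by apply: dvdp_trans uf; rewrite uE -(subnK n_gt1) exprD dvdp_mulIr.
have /size_poly1P[c c0 vE] : size v == 1 by rewrite v1.
by move: u_gt1; rewrite uE vE -polyC_exp size_polyC; case: (_ != 0).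
Qed.

Lemma square_part_exists f : f \is monic ->
  exists a b, [/\ a \is monic, b \is monic, separable_poly b & f = a ^+ 2 * b].
Proof.
have [n] := ubnP (size f); elim: n f => // n IHn f; rewrite ltnS => szf f_monic.
have [sep_f|nsep_f] := boolP (separable_poly f).
  by exists 1, f; rewrite monic1 expr1n mul1r.
have /existsNP[a /not_implyP[a2f /negP sza]] :
    ~ (forall a, a ^+ 2 %| f -> size a == 1).
  by move/separable_squarefree; exact/negP.
have f0 := monic_neq0 f_monic.
have a0 : a != 0.
  by apply: contraTneq a2f => ->; rewrite expr0n dvd0p.
pose c := (lead_coef a)^-1 *: a.
have c_monic : c \is monic.
  by rewrite monicE lead_coefZ mulVf // lead_coef_eq0.
have lc0 : (lead_coef a)^-1 != 0 by rewrite invr_eq0 lead_coef_eq0.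
have /dvdpP[q fE] : c ^+ 2 %| f by rewrite exprZn dvdpZl // expf_neq0.
have q_monic : q \is monic by rewrite -(monicMr _ (monic_exp 2 c_monic)) -fE.
have szq : (size q < n)%N.
  have c2_gt1 : (1 < size (c ^+ 2))%N.
    have c_gt1 : (1 < size c)%N.
      by rewrite size_scale // ltn_neqAle eq_sym sza size_poly_gt0.
    have := size_exp c 2; case: (size c) c_gt1 => [|[|n']] // _.
    by case: (size _) => [|[|]].
  apply: leq_trans szf; rewrite fE size_Mmonic ?monic_neq0 ?monic_exp //.
  by rewrite -(subnKC c2_gt1) addnC !addSn /= ltnS leq_addl.
have [a1 [b [a1_monic b_monic sep_b qE]]] := IHn q szq q_monic.
exists (c * a1), b; split=> //; first by rewrite monicMl.
by rewrite fE qE exprMn; ring.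
Qed.

(** Dividing by [g = gcd(a, a')], the cofactor [c] of [a] satisfies
    [c^2 | c'^2 b'] with [c] and [c'] coprime, hence [c^2 | b'] and [c] is
    constant. *)
Lemma square_part_dvd a b a' b' :
  a != 0 -> separable_poly b' -> a ^+ 2 * b = a' ^+ 2 * b' -> a %| a'.
Proof.
move=> a0 sep_b' E; set g := gcdp a a'.
have g0 : g != 0 by rewrite gcdp_eq0 negb_and a0.
pose c := a %/ g; pose c' := a' %/ g.
have aE : a = c * g by rewrite divpK // dvdp_gcdl.
have aE' : a' = c' * g by rewrite divpK // dvdp_gcdr.
have co_c : coprimep c c' by rewrite coprimep_div_gcd ?a0.
have : c ^+ 2 %| c' ^+ 2 * b'.
  rewrite -(dvdp_mul2r _ _ (expf_neq0 2 g0)) [X in _ %| X]mulrAC -!exprMn.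
  rewrite -aE -aE' -E; exact: dvdp_mulIl.
rewrite Gauss_dvdpr; last by rewrite coprimep_expl // coprimep_expr.
move/(proj1 (separable_squarefree b') sep_b'); rewrite size_poly_eq1 => c1.
by rewrite aE (eqp_dvdl _ (eqp_mulr g c1)) mul1r dvdp_gcdr.
Qed.

Lemma square_part_unique a b a' b' :
  a \is monic -> a' \is monic -> separable_poly b -> separable_poly b' ->
  a ^+ 2 * b = a' ^+ 2 * b' -> a = a' /\ b = b'.
Proof.
move=> am am' sb sb' E.
have aa' : a = a'.
  apply/eqP; rewrite -eqp_monic // /eqp.
  by rewrite (square_part_dvd _ sb' E) ?(square_part_dvd _ sb (esym E)) ?monic_neq0.
split=> //; apply: (mulfI (expf_neq0 2 (monic_neq0 am))).
by rewrite E aa'.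
Qed.
End Perfect.

Section Count.
Variable k : finFieldType.
Implicit Types a b q : {poly k}.

Lemma size_sqrM a b : a \is monic -> b \is monic ->
  size (a ^+ 2 * b) = ((size a).-1.*2 + size b)%N.
Proof.
move=> a_monic b_monic; rewrite size_Mmonic ?monic_neq0 ?monic_exp //.
have := size_exp a 2; have : size (a ^+ 2) != 0%N.
  by rewrite size_poly_eq0 monic_neq0 ?monic_exp.
by case: (size (a ^+ 2)) => // s _ /= ->; rewrite muln2.
Qed.

Lemma size_monic_MXaddC q (c : k) : q \is monic ->
  size (q * 'X + c%:P) = (size q).+1.
Proof. by move=> q_monic; rewrite size_MXaddC (negPf (monic_neq0 q_monic)). Qed.

Lemma monic_MXaddC q (c : k) :
  q != 0 -> (q * 'X + c%:P \is monic) = (q \is monic).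
Proof.
move=> q0; rewrite !monicE lead_coefDl ?lead_coefMX //.
by rewrite size_mulX // ltnS (leq_trans (size_polyC_leq1 _)) // size_poly_gt0.
Qed.

Lemma MXaddC_inj q q' (c c' : k) :
  q * 'X + c%:P = q' * 'X + c'%:P -> q = q' /\ c = c'.
Proof.
move=> E; have cc' : c = c'.
  by have := congr1 (fun f => f.[0]) E; rewrite !hornerMXaddC !mulr0 !add0r.
split=> //; apply: (mulIf (monic_neq0 (monicX k))).
by move: E; rewrite cc' => /addIr.
Qed.

(** The map [F] below is the bijection [(c, a^2 b) |-> (a X + c)^2 b]; its
    injectivity and surjectivity both come from the uniqueness of the square
    part. *)
Lemma card_inseparable n :
  #|[set t : n.+2.-tuple k | ~~ separable_poly (monic_of_coefs t)]|
    = (#|k| ^ n.+1)%N.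
Proof.
have /choice[sq sqP] : forall h : n.-tuple k, exists ab : {poly k} * {poly k},
    [/\ ab.1 \is monic, ab.2 \is monic, separable_poly ab.2 &
        monic_of_coefs h = ab.1 ^+ 2 * ab.2].
  move=> h; have [a [b ab]] := square_part_exists (monic_of_coefs_monic h).
  by exists (a, b).
pose F (ch : k * n.-tuple k) : {poly k} :=
  ((sq ch.2).1 * 'X + ch.1%:P) ^+ 2 * (sq ch.2).2.
have F_monic ch : (sq ch.2).1 * 'X + ch.1%:P \is monic /\ F ch \is monic.
  have [am bm _ _] := sqP ch.2.
  suff lm : (sq ch.2).1 * 'X + ch.1%:P \is monic by rewrite /F monicMl ?monic_exp.
  by rewrite monic_MXaddC ?monic_neq0.
(* Passing from [a] to [a X + c] raises the degree of [a^2 b] by 2. *)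
have size_F ch : size (F ch) = n.+3.
  have [am bm _ /(congr1 (fun q : {poly k} => size q))] := sqP ch.2.
  rewrite size_monic_of_coefs size_sqrM // size_sqrM ?(F_monic ch).1 //.
  rewrite size_monic_MXaddC //= => ->.
  have : size (sq ch.2).1 != 0%N by rewrite size_poly_eq0 monic_neq0.
  by case: (size _).
have F_inj : injective F.
  move=> [c h] [c' h'] E.
  have [_ _ sb hE] := sqP h; have [_ _ sb' hE'] := sqP h'.
  have [] := square_part_unique (F_monic (c, h)).1 (F_monic (c', h')).1 sb sb' E.
  move=> /MXaddC_inj[/= aa' ->] bb'; congr (_, _).
  by apply: (can_inj (@monic_of_coefsK _ _)); rewrite hE hE' aa' bb'.
have FK ch : monic_of_coefs (coefs_of n.+2 (F ch)) = F ch.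
  by rewrite coefs_ofK ?(F_monic ch).2.
suff -> : [set t : n.+2.-tuple k | ~~ separable_poly (monic_of_coefs t)] =
    [set coefs_of n.+2 (F ch) | ch in [set: k * n.-tuple k]].
  rewrite card_imset ?cardsT ?card_prod ?card_tuple ?expnS // => ch ch' E.
  by apply: F_inj; rewrite -FK E FK.
apply/setP => t; rewrite inE; apply/idP/imsetP => [nsep|[[c h] _ ->]].
  have [A [b [Am bm sb tE]]] := square_part_exists (monic_of_coefs_monic t).
  have [q [c AE]] : exists q c, A = q * 'X + c%:P.
    elim/poly_ind: (A) => [|q c _]; last by exists q, c.
    by exists 0, 0; rewrite mul0r addr0.
  have q0 : q != 0.
    apply: contraNneq nsep => q0; move: Am; rewrite tE AE q0 mul0r add0r.
    by rewrite monicE lead_coefC => /eqP ->; rewrite expr1n mul1r.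
  have qm : q \is monic by rewrite -(monic_MXaddC c q0) -AE.
  have hE : monic_of_coefs (coefs_of n (q ^+ 2 * b)) = q ^+ 2 * b.
    rewrite coefs_ofK ?monicMl ?monic_exp //.
    have := congr1 (fun q : {poly k} => size q) tE.
    rewrite size_monic_of_coefs size_sqrM // AE size_monic_MXaddC // size_sqrM //=.
    have : size q != 0%N by rewrite size_poly_eq0.
    by case: (size q) => // s _ /= [].
  exists (c, coefs_of n (q ^+ 2 * b)); rewrite ?inE //.
  apply: (can_inj (@monic_of_coefsK _ _)); rewrite FK tE AE /F /=.
  have [am bm' sb' E] := sqP (coefs_of n (q ^+ 2 * b)).
  by have [<- <-] := square_part_unique qm am sb sb' (etrans (esym hE) E).
rewrite FK; apply/negP => /(proj1 (separable_squarefree _)).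
move=> /(_ ((sq h).1 * 'X + c%:P) (dvdp_mulIl _ _)).
have [am _ _ _] := sqP h; rewrite size_monic_MXaddC // eqSS size_poly_eq0.
by rewrite (negPf (monic_neq0 am)).
Qed.

Lemma card_separable n : (2 <= n)%N ->
  #|[set t : n.-tuple k | separable_poly (monic_of_coefs t)]|
    = (#|k| ^ n - #|k| ^ n.-1)%N.
Proof.
case: n => [|[|n]] // _; rewrite -(card_inseparable n) -(card_tuple n.+2 k).
rewrite -(cardsC [set t | separable_poly (monic_of_coefs t)]).
set C := ~: _.
suff -> : C = [set t : n.+2.-tuple k | ~~ separable_poly (monic_of_coefs t)].
  by rewrite addnK.
by apply/setP => t; rewrite !inE.
Qed.
End Count.

(** * The p-adic integers and their residues *)

Section Padic.
Variable p : nat.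
Hypothesis p_prime : prime p.
Implicit Types x y : padic_int p.

(** The residue [x 0] lives in ['Z_(p ^ 1)], whose type carries no field
    structure, hence the detour through [nat].  The primality proof is an
    argument because the ring morphism structure attached below depends on it. *)
Definition padic_red (pp : prime p) x : 'F_p := (x 0%N : nat)%:R.
Local Notation red := (padic_red p_prime).

Lemma natr_mod_expS n m : ((m %% (Zp_trunc (p ^ n.+1)).+2)%:R : 'F_p) = m%:R.
Proof.
have pn : (p %| (Zp_trunc (p ^ n.+1)).+2)%N.
  by rewrite Zp_cast ?dvdn_exp // -(expn0 p) ltn_exp2l ?prime_gt1.
by rewrite -Fp_nat_mod // modn_dvdm // Fp_nat_mod.
Qed.

Fact padic_red_nmod_morphism : nmod_morphism red.
Proof.
split=> [|x y]; first by rewrite /padic_red.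
by rewrite /padic_red /= natr_mod_expS natrD.
Qed.
Fact padic_red_monoid_morphism : monoid_morphism red.
Proof.
split=> [|x y]; first by rewrite /padic_red.
by rewrite /padic_red /= natr_mod_expS natrM.
Qed.
HB.instance Definition _ :=
  GRing.isNmodMorphism.Build (padic_int p) 'F_p red padic_red_nmod_morphism.
HB.instance Definition _ :=
  GRing.isMonoidMorphism.Build (padic_int p) 'F_p red padic_red_monoid_morphism.

Lemma padic_red_natr (r : 'F_p) : red (r : nat)%:R = r.
Proof. by rewrite rmorph_nat natr_Zp. Qed.

Lemma padic_red_res x n : ((x n : nat)%:R : 'F_p) = red x.
Proof.
by elim: n => // n <-; rewrite -(zp_redK x n) /= natr_mod_expS.
Qed.

(** Each residue of [x] modulo a power of [p] is prime to [p], and the inverses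
    form a coherent sequence since reduction preserves them. *)
Lemma padic_red_local x : red x != 0 -> exists y, y * x = 1.
Proof.
move=> x0.
have x_unit n : x n \is a GRing.unit.
  rewrite -[x n]natr_Zp unitZpE; last by rewrite -(expn0 p) ltn_exp2l ?prime_gt1.
  by rewrite coprime_pexpl // -unitFpE // padic_red_res unitfE.
have inv_coherent : coherent (fun n => (x n)^-1).
  apply/asboolP => n; apply: (mulIr (x_unit n)).
  by rewrite mulVr ?x_unit // -[X in _ * X]zp_redK -zp_redM mulVr ?x_unit ?zp_red1.
by exists (PadicInt inv_coherent); apply: padicP => n; exact: mulVr (x_unit n).
Qed.

End Padic.

Lemma map_monic_of_coefs (A B : comNzRingType) (phi : {rmorphism A -> B})
    d (a : d.-tuple A) :
  map_poly phi (monic_of_coefs a) = monic_of_coefs (map_tuple phi a).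
Proof.
rewrite /monic_of_coefs rmorphD /= map_polyXn; congr (_ + _).
apply/polyP => i; rewrite coef_map !coef_poly.
case: ltnP => [ltid|_]; last exact: rmorph0.
by rewrite [RHS](nth_map 0) ?size_tuple.
Qed.

Lemma separable_monic_of_coefs p (p_prime : prime p) d
    (a : d.-tuple (padic_int p)) : (2 <= d)%N ->
  separable_monic d (monic_of_coefs a) <->
  separable_poly (monic_of_coefs (map_tuple (padic_red p_prime) a)).
Proof.
move=> d_ge2; have a_monic := monic_of_coefs_monic a.
have sza := size_monic_of_coefs a.
rewrite -map_monic_of_coefs -separable_polynomialP //; last 2 first.
- exact: padic_red_local.
- by rewrite sza ltnS ltnW.
by split=> [[]|].
Qed.

(** * Haar measure of residue classes *)

Local Open Scope classical_set_scope.

Section FiniteUnion.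
Context d (X : measurableType d) (R : realType) (mu : {measure set X -> \bar R}).
Variables (T : finType) (D : {set T}) (F : T -> set X).
Hypotheses (mF : forall t, measurable (F t)) (tF : trivIset setT F).

Lemma measurable_finset_bigcup : measurable (\bigcup_(t in [set` D]) F t).
Proof. exact: fin_bigcup_measurable. Qed.

Lemma measure_finset_bigcup :
  mu (\bigcup_(t in [set` D]) F t) = (\sum_(t in D) mu (F t))%E.
Proof.
rewrite measure_fin_bigcup //; last exact: sub_trivIset tF.
rewrite -big_enum [RHS]fsbig_seq ?enum_uniq //=.
apply: eq_fsbigl.
by apply/seteqP; split=> t /=; rewrite mem_enum.
Qed.
End FiniteUnion.

Section Haar.
Variables (R : realType) (p : nat) (mu : probability (padic_int p) R).
Hypotheses (p_prime : prime p) (mu_haar : is_haar mu).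
Local Notation red := (padic_red p_prime).

Definition residue_class (r : 'F_p) : set (padic_int p) := [set x | red x = r].

Lemma measurable_residue_class r : measurable (residue_class r).
Proof.
have : padic_open (residue_class r).
  by move=> x xr; exists 0%N => y yx; rewrite /residue_class /= -xr /padic_red yx.
exact: sub_sigma_algebra.
Qed.

Lemma residue_class_translate r :
  residue_class r = [set (r : nat)%:R + x | x in residue_class 0].
Proof.
apply/seteqP; split => [x xr|_ [x x0 <-]]; rewrite /residue_class /=; last first.
  by rewrite rmorphD /= padic_red_natr x0 addr0.
exists (x - (r : nat)%:R); last by rewrite addrC subrK.
by rewrite /residue_class /= rmorphB /= padic_red_natr xr subrr.
Qed.

(** The [p] classes are translates of the class of 0 and partition [Z_p]. *)
Lemma haar_residue_class r : mu (residue_class r) = (p%:R^-1)%:E.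
Proof.
have E s : mu (residue_class s) = mu (residue_class 0).
  by rewrite residue_class_translate mu_haar //; exact: measurable_residue_class.
have : (\sum_(s in [set: 'F_p]%SET) mu (residue_class s))%E = 1%E.
  rewrite -measure_finset_bigcup; last 2 first.
  - exact: measurable_residue_class.
  - by move=> s t _ _ [x [<- <-]].
  rewrite -(@probability_setT _ _ _ mu); congr (mu _).
  by apply/seteqP; split => // x _; exists (red x) => //=; rewrite inE.
rewrite E; under eq_bigr do rewrite E.
have : mu (residue_class 0) \is a fin_num.
  by apply: fin_num_measure; exact: measurable_residue_class.
move/fineK <-; rewrite sumEFin => -[]; rewrite sumr_const cardsT card_Fp // => h.
congr (_%:E).
have p0 : p%:R != 0 :> R by rewrite pnatr_eq0 -lt0n prime_gt0.
by apply: (mulfI p0); rewrite divff // mulr_natl.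
Qed.
End Haar.

Definition residue_box p (p_prime : prime p) d (r : d.-tuple 'F_p) :
    set (d.-tuple (padic_int p)) :=
  [set a | forall i, residue_class p_prime (tnth r i) (tnth a i)].

Lemma residue_boxE p (p_prime : prime p) d (r : d.-tuple 'F_p)
    (a : d.-tuple (padic_int p)) :
  residue_box p_prime r a <-> map_tuple (padic_red p_prime) a = r.
Proof.
split=> [ar|<- i]; last by rewrite /residue_class /= tnth_map.
by apply: eq_from_tnth => i; rewrite tnth_map; exact: ar.
Qed.

Lemma measurable_box dT (T : measurableType dT) n (A : 'I_n -> set T) :
  (forall i, measurable (A i)) ->
  measurable [set t : n.-tuple T | forall i, A i (tnth t i)].
Proof.
move=> mA; rewrite (_ : [set t | _] = \bigcap_(i in [set: 'I_n])
  ((@tnth n T)^~ i @^-1` A i)); last first.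
  by apply/seteqP; split => t /= At i; [move=> _; exact: At|exact: (At i I)].
apply: fin_bigcap_measurable => // i _; rewrite -[X in measurable X]setTI.
exact: measurable_tnth.
Qed.

Theorem theorem3 (R : realType) (p d : nat) (mu : probability (padic_int p) R)
    (p_prime : prime p) (d_ge2 : (2 <= d)%N) (mu_haar : is_haar mu) :
  let S : set (d.-tuple (padic_int p)) :=
    @monic_of_coefs (padic_int p) d @^-1` separable_monic d in
  measurable S /\ power_measure mu d S = (1 - (p%:R)^-1)%:E.
Proof.
move=> S.
pose D := finset (fun r : d.-tuple 'F_p => separable_poly (monic_of_coefs r)).
have SE : S = \bigcup_(r in [set` D]) residue_box p_prime r.
  apply/seteqP; split=> [a|a [r Dr /residue_boxE ar]].
    move=> /(separable_monic_of_coefs p_prime _ d_ge2) sep_a.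
    by exists (map_tuple (padic_red p_prime) a); [rewrite /= inE|exact/residue_boxE].
  apply/(separable_monic_of_coefs p_prime _ d_ge2).
  by rewrite ar; move: Dr; rewrite /= inE.
have m_class r : measurable (residue_class p_prime r).
  exact: measurable_residue_class.
have m_box (r : d.-tuple 'F_p) : measurable (residue_box p_prime r).
  by apply: (@measurable_box _ _ _ (fun i => residue_class p_prime (tnth r i))).
have box_disj : trivIset setT (@residue_box p p_prime d).
  by move=> r s _ _ [a [/residue_boxE <- /residue_boxE <-]].
rewrite SE; split; first exact: measurable_finset_bigcup.
rewrite measure_finset_bigcup //.
rewrite (eq_bigr (fun=> ((p%:R^-1) ^+ d)%:E)) => [|r _]; last first.
  apply: etrans (power_measure_box mu
    (A := fun i => residue_class p_prime (tnth r i)) _) _ => //.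
  rewrite (eq_bigr (fun=> (p%:R^-1)%:E)) => [|i _]; last exact: haar_residue_class.
  by rewrite prodEFin prodr_const card_ord.
rewrite sumEFin sumr_const card_separable // card_Fp //; congr (_%:E).
have p0 : p%:R != 0 :> R by rewrite pnatr_eq0 -lt0n prime_gt0.
rewrite -[LHS]mulr_natl natrB ?leq_exp2l ?prime_gt1 ?leq_pred // !natrX.
rewrite -(prednK (ltnW d_ge2)) /= exprVn mulrBl divff ?expf_neq0 //.
by rewrite exprS invfM mulrCA divff ?expf_neq0 // mulr1.
Qed.
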